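(* Let $D$ be any (non-empty) logarithmically convex complete Reinhardt domain in $\mathbb{C}^N$ with logarithmic image $G=\lambda(D)$. Let $h$ be the support function of $G$, with domain restricted to $PS_N$. Then the domain of convergence of a (convergent) power series $g(z)=\sum_J c_Jz^J$ is $D$ if and only if $h$ equals (on $PS_N$) the convex closure of the function $c$ given by $$c(\alpha)=-\sup\Big\{\limsup_{n\to\infty}\frac{\log|c_{J^n}|}{|J^n|} \; : \; \{J^n\}\in S_\alpha\Big\}$$ for all $\alpha\in PS_N$.
   Context: Notation. $\mathbb{N}_0=\mathbb{N}\cup\{0\}$. For $J\in\mathbb{N}_0^N$, $|J|=j_1+\dots+j_N$. $PS_N=\{x\in\mathbb{R}^N: x_1+\dots+x_N=1,\ x_j\ge 0 \text{ for all } j\}$. For $\alpha\in PS_N$, $S_\alpha$ is the set of all sequences $\{J^n\}$ in $\mathbb{N}_0^N\setminus\{0\}$ with $J^n/|J^n|\to\alpha$ and $|J^n|\to\infty$ as $n\to\infty$. The convention $\log 0=-\infty$ is used. The domain of convergence of a power series $\sum_{J\in\mathbb{N}_0^N} c_Jz^J$ is the interior of the set of points of $\mathbb{C}^N$ at which the series converges absolutely; power series are assumed convergent, i.e. with non-empty domain of convergence. $\lambda(z)=(\log|z_1|,\dots,\log|z_N|)$, defined for $z$ with no zero coordinate; the logarithmic image $\lambda(D)$ is the image under $\lambda$ of the points of $D$ with no zero coordinate. A domain $D\subset\mathbb{C}^N$ is complete Reinhardt if it is a union of open polydiscs centered at the origin; it is logarithmically convex if $\lambda(D)\subset\mathbb{R}^N$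 is convex. The support function of a convex set $G\subset\mathbb{R}^N$ is $h_G(u)=\sup\{\langle x,u\rangle: x\in G\}\in(-\infty,\infty]$. The convex closure of a function $f$ is $\mathrm{cl}(\mathrm{conv} f)$: here $\mathrm{conv} f$ is the greatest convex function majorized by $f$, and $\mathrm{cl}$ denotes the lower semicontinuous regularization, $\mathrm{cl} f(x)=\liminf_{y\to x}f(y)$. A function given on a subset of $\mathbb{R}^N$ is extended to $\mathbb{R}^N$ by the value $+\infty$. *)

(* Defs.v *)
From HB Require Import structures.
From mathcomp Require Import all_boot all_order all_algebra.
From mathcomp Require Import complex.
From mathcomp Require Import all_classical all_reals all_analysis.

Set Implicit Arguments.
Unset Strict Implicit.
Unset Printing Implicit Defensive.

Import Order.TTheory GRing.Theory Num.Theory.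
Import numFieldTopology.Exports numFieldNormedType.Exports.

Local Open Scope classical_set_scope.
Local Open Scope ring_scope.

(* [R[i]] itself carries no canonical topology; presented as a
   [numClosedFieldType] it gets the one induced by its modulus, and
   ['rV[Cplx R]_N] gets the product topology. *)
Definition Cplx (R : realType) : numClosedFieldType := R[i]%C.

(* The generic norm [`|z|] is valued in [R[i]]; this one is valued in [R]. *)
Definition cabs (R : realType) (z : Cplx R) : R := ComplexField.Normc.normc z.

Definition mindex (N : nat) : choiceType := {ffun 'I_N -> nat}.

Section Definitions.
Variables (R : realType) (N : nat).
Implicit Types (D : set 'rV[Cplx R]_N) (c : mindex N -> Cplx R).
Implicit Types (G : set 'rV[R]_N) (f g : 'rV[R]_N -> \bar R).

Definition mindex0 : mindex N := [ffun=> 0%N].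

Definition mlength (J : mindex N) : nat := (\sum_i J i)%N.

Definition monomial (J : mindex N) (z : 'rV[Cplx R]_N) : Cplx R :=
  \prod_i z 0 i ^+ J i.

Definition abs_convergent c (z : 'rV[Cplx R]_N) : Prop :=
  summable [set: mindex N] (fun J => (cabs (c J * monomial J z))%:E).

Definition domain_of_convergence c : set 'rV[Cplx R]_N :=
  interior [set z | abs_convergent c z].

Definition domain D : Prop := [/\ D !=set0, open D & connected D].

Definition polydisc (r : 'rV[R]_N) : set 'rV[Cplx R]_N :=
  [set z | forall i, cabs (z 0 i) < r 0 i].

Definition complete_reinhardt D : Prop :=
  exists2 A : set 'rV[R]_N,
    (forall r, A r -> forall i, 0 < r 0 i) & D = \bigcup_(r in A) polydisc r.

Definition log_map (z : 'rV[Cplx R]_N) : 'rV[R]_N :=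
  \row_i ln (cabs (z 0 i)).

Definition log_image D : set 'rV[R]_N :=
  [set log_map z | z in [set z | D z /\ forall i, z 0 i != 0]].

Definition log_convex D : Prop := convex_set (log_image D).

Definition support_function G (u : 'rV[R]_N) : \bar R :=
  ereal_sup [set (\sum_i x 0 i * u 0 i)%:E | x in G].

Definition PS : set 'rV[R]_N :=
  [set x | \sum_i x 0 i = 1 /\ forall i, 0 <= x 0 i].

Definition Sseq (alpha : 'rV[R]_N) : set (nat -> mindex N) :=
  [set J | [/\ forall n, J n <> mindex0,
      (\row_i ((J n i)%:R / (mlength (J n))%:R) : 'rV[R]_N)
        @[n --> \oo] --> alpha
    & mlength (J n) @[n --> \oo] --> \oo]].

(* [lne] is the extended logarithm, with [lne 0 = -oo]. *)
Definition coef_fun c (alpha : 'rV[R]_N) : \bar R :=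
  (- ereal_sup
    [set limn_esup
       (fun n => lne (cabs (c (J n)))%:E * ((mlength (J n))%:R^-1)%:E)
    | J in Sseq alpha])%E.

Definition extend (A : set 'rV[R]_N) f : 'rV[R]_N -> \bar R :=
  patch (cst +oo%E) A f.

(* Extended-real-valued functions are convex when their epigraph is, so that
   no convention for [+oo - oo] is needed. *)
Definition epigraph f : set ('rV[R]_N * R^o) :=
  [set p | (f p.1 <= p.2%:E)%E].

Definition convex_efun f : Prop := convex_set (epigraph f).

(* The greatest convex function majorized by [f], constructed as the pointwise
   supremum of all such functions; see [convf_greatest]. *)
Definition convf f (x : 'rV[R]_N) : \bar R :=
  ereal_sup [set g x | g in
    [set g | convex_efun g /\ forall y, (g y <= f y)%E]].

(* The neighbourhoods of [x] are not punctured: the lower limit takes the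
   value at [x] itself into account. *)
Definition clf f (x : 'rV[R]_N) : \bar R := limf_einf f (nbhs x).

Definition convex_closure f : 'rV[R]_N -> \bar R := clf (convf f).

Lemma convf_greatest f :
  [/\ convex_efun (convf f),
      (forall x, (convf f x <= f x)%E)
    & forall g, convex_efun g -> (forall x, (g x <= f x)%E) ->
        forall x, (g x <= convf f x)%E].
Proof.
split.
- move=> p q t; rewrite !inE /epigraph /= => fp fq.
  apply: ge_ereal_sup => _ [g [cvxg gf] <-].
  have le_g y : (g y <= convf f y)%E by apply: ereal_sup_ubound; exists g.
  have := cvxg p q t; rewrite !inE /epigraph /=; apply.
  + exact: le_trans fp.
  + exact: le_trans fq.
- by move=> x; apply: ge_ereal_sup => _ [g [_ gf] <-].
- by move=> g cvxg gf x; apply: ereal_sup_ubound; exists g.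
Qed.

End Definitions.

(* Main.v *)
(* Put x = (log |z_1|, ..., log |z_N|).  Comparing the terms of the series with
   geometric ones, and using the compactness of PS_N to extract a convergent
   sequence of directions J/|J| from any sequence of large terms, one finds that
   x lies in the logarithmic image of the domain of convergence iff
   <x + e1, .> <= c on PS_N for some e > 0.  Since G is convex, open and
   downward closed, the separation theorem shows likewise that x lies in G iff
   <x + e1, .> <= h on PS_N for some e > 0.  On the hyperplane containing PS_N
   every affine function agrees with a linear one, so cl(conv c) is the supremum
   there of the linear functions below c; this makes the two conditions on x
   equivalent iff h = cl(conv c). *)
Require Import Defs.
From mathcomp Require Import all_boot all_order all_algebra.
From mathcomp Require Import interval_inference ring lra complex.
From mathcomp Require Import all_classical all_reals all_analysis.
Import Order.TTheory GRing.Theory Num.Theory.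
Import numFieldTopology.Exports numFieldNormedType.Exports.

Local Open Scope classical_set_scope.
Local Open Scope ring_scope.

(** * Separation of a point from a convex set *)

Section Separation.
Context {R : realType} {n : nat}.
Implicit Types (x y u v : 'rV[R]_n) (C : set 'rV[R]_n).

(** Convertible to the sum inside [support_function]. *)
Definition dot x u : R := \sum_i x 0 i * u 0 i.

Lemma dotC x u : dot x u = dot u x.
Proof. by apply: eq_bigr => i _; rewrite mulrC. Qed.

Lemma dotDl x y u : dot (x + y) u = dot x u + dot y u.
Proof. by rewrite -big_split; apply: eq_bigr => i _; rewrite mxE mulrDl. Qed.

Lemma dotZl a x u : dot (a *: x) u = a * dot x u.
Proof. by rewrite mulr_sumr; apply: eq_bigr => i _; rewrite mxE mulrA. Qed.

Lemma dotNl x u : dot (- x) u = - dot x u.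
Proof. by rewrite -scaleN1r dotZl mulN1r. Qed.

Lemma dotBl x y u : dot (x - y) u = dot x u - dot y u.
Proof. by rewrite dotDl dotNl. Qed.

Lemma dotDr x u v : dot x (u + v) = dot x u + dot x v.
Proof. by rewrite !(dotC x) dotDl. Qed.

Lemma dotZr a x u : dot x (a *: u) = a * dot x u.
Proof. by rewrite !(dotC x) dotZl. Qed.

Lemma dotBr x u v : dot x (u - v) = dot x u - dot x v.
Proof. by rewrite !(dotC x) dotBl. Qed.

Lemma dotNr x u : dot x (- u) = - dot x u.
Proof. by rewrite !(dotC x) dotNl. Qed.

(** Passes between the Euclidean form and the maximum norm carried by row vectors. *)
Lemma sqr_coord_le_dot x i : x 0 i ^+ 2 <= dot x x.
Proof.
rewrite /dot (bigD1 i)//= -expr2 lerDl; apply: sumr_ge0 => j _.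
by rewrite -expr2 sqr_ge0.
Qed.

Lemma continuous_affine (T : topologicalType) (f : T -> R) (a b : R) :
  continuous f -> continuous (fun t => a + b * f t).
Proof.
move=> cf t; apply: cvgD; first exact: cvg_cst.
by apply: cvgMr; exact: cf.
Qed.

Lemma continuous_dot (T : topologicalType) (f g : T -> 'rV[R]_n) :
    (forall i, continuous (fun t => f t 0 i)) ->
    (forall i, continuous (fun t => g t 0 i)) ->
  continuous (fun t => dot (f t) (g t)).
Proof.
move=> cf cg; apply: continuous_big => [|i _ t]; first exact: add_continuous.
apply: (@continuousM R T (fun t => f t 0 i) (fun t => g t 0 i)).
  exact: cf.
exact: cg.
Qed.

Lemma convex_combination C x y (t : R) : convex_set C -> C x -> C y ->
  0 <= t <= 1 -> C (t *: x + (1 - t) *: y).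
Proof.
move=> cC Cx Cy /andP[t0 t1].
have := cC x y (Itv01 t0 t1).
by rewrite !inE => /(_ Cx Cy).
Qed.

(** The normal is [y - p], where [p] is a point of the closure of [C] nearest to [y]; as [e] bounds
    squared distances, it also serves as the gap [d]. *)
Lemma convex_separation C y (e : R) : convex_set C -> 0 < e ->
    (forall g, C g -> e <= dot (g - y) (g - y)) ->
  exists v, exists2 d, 0 < d & forall g, C g -> dot v g + d <= dot v y.
Proof.
move=> cC e0 Ce.
have [[g0 Cg0]|C0] := pselect (C !=set0); last first.
  by exists 0, 1 => // g Cg; case: C0; exists g.
pose dist x := dot (x - y) (x - y).
have ctsB (t : R) (g : 'rV[R]_n) :
    continuous (fun q : 'rV[R]_n => dist (t *: g + (1 - t) *: q)).
  have h (i : 'I_n) :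
      continuous (fun q : 'rV[R]_n => (t *: g + (1 - t) *: q - y) 0 i).
    have -> : (fun q : 'rV[R]_n => (t *: g + (1 - t) *: q - y) 0 i) =
              (fun q => (t * g 0 i - y 0 i) + (1 - t) * q 0 i).
      by apply/funext => q; rewrite !mxE; ring.
    by apply: continuous_affine; exact: coord_continuous.
  exact: (continuous_dot _ _ _ h h).
have cts : continuous dist.
  have h (i : 'I_n) : continuous (fun q : 'rV[R]_n => (q - y) 0 i).
    have -> : (fun q : 'rV[R]_n => (q - y) 0 i) = (fun q => - y 0 i + 1 * q 0 i).
      by apply/funext => q; rewrite !mxE; ring.
    by apply: continuous_affine; exact: coord_continuous.
  exact: (continuous_dot _ _ _ h h).
have clge f a : continuous f -> (forall q, C q -> a <= f q) ->
    forall q, closure C q -> a <= f q :> R.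
  move=> cf Cf q.
  have : closed (f @^-1` [set r | a <= r]).
    exact: closed_comp (fun x _ => cf x) (@closed_ge _ _).
  by rewrite closure_id => /esym E /(closureS Cf); rewrite E.
(* Restricting to points at most as far as [g0] makes the minimisation compact without losing the
   minimum. *)
pose K := closure C `&` [set q | dist q <= dist g0].
have K0 : K !=set0 by exists g0; split; [exact: subset_closure|rewrite /= lexx].
have cK : compact K.
  apply: bounded_closed_compact.
    exists (`|y| + (dist g0 + 1)); split => [|M /ltW MM q [_ /= qK]].
      exact: num_real.
    have {}qK : `|q - y| <= dist g0 + 1.
      rewrite /Num.norm/= mx_normrE; apply/bigmax_leP; split => [|[j i] _ /=].
        by rewrite addr_ge0// (le_trans _ qK)// sumr_ge0// => i _;
          rewrite -expr2 sqr_ge0.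
      rewrite (ord1 j); have := le_trans (sqr_coord_le_dot (q - y) i) qK.
      rewrite ler_norml => h; apply/andP; split; nra.
    by rewrite -(subrK y q) (le_trans (ler_normD _ _))// (le_trans _ MM)//
      addrC lerD2l.
  apply: closedI; first exact: closed_closure.
  exact: closed_comp (fun x _ => cts x) (@closed_le _ _).
have [p /set_mem[clp _] pmin] := compact_EVT_min K0 cK (continuous_subspaceT cts).
have {}pmin q : C q -> dist p <= dist q.
  move=> Cq; have [qg0|/ltW g0q] := leP (dist q) (dist g0).
    by apply: pmin; rewrite inE; split => //; exact: subset_closure.
  apply: le_trans g0q; apply: pmin; rewrite inE.
  by split; [exact: subset_closure|rewrite /= lexx].
have ep : e <= dist p by apply: clge clp.
(* Convexity gives this with [q] in [C] in place of [p]; [clge] then lets [q] tend to [p]. *)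
have var g t : C g -> 0 <= t <= 1 -> dist p <= dist (t *: g + (1 - t) *: p).
  move=> Cg t01; apply: (clge _ _ (ctsB t g)) clp => q Cq.
  by apply: pmin; exact: convex_combination.
exists (y - p), e => // g Cg.
(* First-order optimality of the nearest point p along the segment [p, g]. *)
have key : dot (y - p) (g - p) <= 0.
  rewrite leNgt; apply/negP => w0.
  set w := dot (y - p) (g - p) in w0.
  set a := dot (g - p) (g - p).
  have a0 : 0 <= a by apply: sumr_ge0 => i _; rewrite -expr2 sqr_ge0.
  have {}var t : 0 <= t <= 1 -> 2 * t * w <= t ^+ 2 * a.
    move=> t01; have := var g t Cg t01; rewrite /dist.
    have -> : t *: g + (1 - t) *: p - y = t *: (g - p) - (y - p).
      by apply/matrixP => i j; rewrite !mxE; ring.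
    have -> (u v : 'rV[R]_n) :
        dot (t *: u - v) (t *: u - v) =
        t ^+ 2 * dot u u - 2 * t * dot v u + dot v v.
      by rewrite dotBl !dotBr !dotZl !dotZr (dotC u v); ring.
    by rewrite -/w -/a -(opprB p y) dotNl dotNr opprK; lra.
  (* The step [t = w / (a + w + 1)] lies in ]0, 1] even if [a = 0], and gives [t ^+ 2 * a < t * w],
     against [var]. *)
  have ? : 0 < a + w + 1 by lra.
  have ht : 0 < w / (a + w + 1) by rewrite divr_gt0.
  have : w / (a + w + 1) <= 1 by rewrite ler_pdivrMr//; lra.
  set t := w / _ in ht * => t1.
  have := var t; rewrite t1 (ltW ht) => /(_ isT).
  have E : t * (a + w + 1) = w by rewrite /t divfK// gt_eqF.
  have -> : t ^+ 2 * a = t * (w - t * w - t).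
    by rewrite expr2 -mulrA; congr (_ * _); move: E; lra.
  have tw : 0 < t * w by rewrite mulr_gt0.
  nra.
rewrite -(subrK p g) dotDr.
have : dot (y - p) y = dot (y - p) p + dist p.
  by rewrite /dist -(opprB y p) dotNl dotNr opprK [in RHS]dotBr; ring.
lra.
Qed.

End Separation.

(** * Support functions and convex closures *)

Section Duality.
Context {R : realType} {N : nat}.
Implicit Types (x y z u v a b : 'rV[R]_N) (G : set 'rV[R]_N).
Implicit Types (f : 'rV[R]_N -> \bar R).

(** Coordinates on [PS] sum to 1, so a constant vector contributes a constant, and affine functions
    on [PS] can be written as linear ones. *)
Lemma dot_shift x (e : R) a : PS a -> dot (x + const_mx e) a = dot x a + e.
Proof.
move=> [sa _]; rewrite dotDl; congr (_ + _).
by rewrite /dot; under eq_bigr do rewrite mxE; rewrite -mulr_sumr sa mulr1.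
Qed.

Lemma dot_delta x i : dot x (delta_mx 0 i) = x 0 i.
Proof.
rewrite /dot (bigD1 i)//= mxE !eqxx mulr1 big1 ?addr0// => j /negPf ji.
by rewrite mxE eqxx ji mulr0.
Qed.

Lemma support_function_ge G x a : G x -> ((dot x a)%:E <= support_function G a)%E.
Proof. by move=> Gx; apply: ereal_sup_ubound; exists x. Qed.

Lemma support_function_le G a (l : \bar R) :
  (forall x, G x -> ((dot x a)%:E <= l)%E) -> (support_function G a <= l)%E.
Proof. by move=> Gl; apply: ge_ereal_sup => _ [x Gx <-]; exact: Gl. Qed.

(** For the converse, if [x] is outside [G], then [x + const_mx e] is at distance at least [e] from
    [G]. A separating normal has nonnegative coordinates because [G] is downward closed; normalised
    to [PS], it contradicts the inequality. *)
Lemma mem_support_function G x :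
    convex_set G -> G !=set0 ->
    (forall y z, G y -> (forall i, z 0 i <= y 0 i) -> G z) ->
    (forall y, G y -> exists2 e : R, 0 < e & G (y + const_mx e)) ->
  G x <-> exists2 e : R, 0 < e &
    forall a, PS a -> ((dot (x + const_mx e) a)%:E <= support_function G a)%E.
Proof.
move=> cG [g0 Gg0] Gdown Gopen; split.
  move=> /Gopen[e e0 Gxe]; exists e => // a _; exact: support_function_ge.
move=> [e e0 hx]; apply: contrapT => nGx.
pose y : 'rV[R]_N := x + const_mx e.
have far g : G g -> e ^+ 2 <= dot (g - y) (g - y).
  move=> Gg.
  have [i gx] : exists i, g 0 i < x 0 i.
    apply: contrapT => /forallNP gx; apply: nGx; apply: Gdown Gg _ => i.
    by rewrite leNgt; apply/negP/gx.
  apply: le_trans (sqr_coord_le_dot _ i); rewrite !mxE.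
  have h : e <= - (g 0 i - (x 0 i + e)) by lra.
  by rewrite -[leRHS]sqrrN; nra.
have [v [d d0 vy]] := convex_separation G y (e ^+ 2) cG (exprn_gt0 _ e0) far.
have v0 i : 0 <= v 0 i.
  rewrite leNgt; apply/negP => vi.
  (* Going down by [T] along the [i]-th axis stays in [G] but raises [dot v] to at least
     [dot v y]. *)
  pose T := (`|dot v y| + `|dot v g0|) / - v 0 i.
  have T0 : 0 <= T by rewrite divr_ge0 ?addr_ge0// oppr_ge0 ltW.
  have Gg : G (g0 - T *: delta_mx 0 i).
    apply: Gdown Gg0 _ => j; rewrite !mxE /= lerBlDr lerDl.
    by rewrite mulr_ge0// ler0n.
  have := vy _ Gg; rewrite dotBr dotZr dot_delta.
  have -> : T * v 0 i = - (`|dot v y| + `|dot v g0|).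
    by rewrite /T invrN mulrN mulNr divfK// lt_eqF.
  have := ler_norm (dot v y); have := ler_norm (- dot v g0); rewrite normrN; lra.
pose s := \sum_i v 0 i.
have s0 : 0 < s.
  rewrite lt_neqAle sumr_ge0// andbT; apply/eqP => s0.
  have vz i : v 0 i = 0.
    have /eqP := esym s0; rewrite psumr_eq0// => /allP/(_ i).
    by rewrite mem_index_enum => /(_ isT)/eqP.
  have v_dot w : dot v w = 0 by rewrite /dot big1// => i _; rewrite vz mul0r.
  by have := vy _ Gg0; rewrite !v_dot add0r leNgt d0.
have PSv : PS (s^-1 *: v).
  split=> [|i]; last by rewrite mxE mulr_ge0// invr_ge0 ltW.
  by under eq_bigr do rewrite mxE; rewrite -mulr_sumr mulVf// gt_eqF.
have := hx _ PSv; apply/negP; rewrite -ltNge.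
apply: (@le_lt_trans _ _ (dot y (s^-1 *: v) - d / s)%:E).
  apply: support_function_le => g Gg; rewrite lee_fin !dotZr -/y.
  rewrite !(dotC _ v) mulrC [_^-1 * _]mulrC -mulrBl ler_pM2r ?invr_gt0//.
  by have := vy _ Gg; lra.
by rewrite lte_fin ltrBlDr ltrDl divr_gt0.
Qed.

Lemma clf_le f x : (clf f x <= f x)%E.
Proof.
rewrite /clf limf_einfE; apply: ge_ereal_sup => _ [V /nbhs_singleton Vx <-].
by apply: ereal_inf_lbound; exists x.
Qed.

Lemma convex_closure_le f x : (convex_closure f x <= f x)%E.
Proof. by apply: le_trans (clf_le _ _) _; case: (convf_greatest f). Qed.

(** Linear functions are convex and continuous, so they remain minorants under both operations of
    the closure. *)
Lemma linear_le_convex_closure f x :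
    (forall a, PS a -> ((dot x a)%:E <= f a)%E) ->
  forall a, ((dot x a)%:E <= convex_closure (extend (@PS R N) f) a)%E.
Proof.
move=> xf.
have lconv a : ((dot x a)%:E <= convf (extend (@PS R N) f) a)%E.
  have [_ _] := convf_greatest (extend (@PS R N) f).
  move=> /(_ (fun a => (dot x a)%:E)); apply.
    move=> p q t; rewrite !inE /epigraph /= !lee_fin => px qx.
    by rewrite dotDr !dotZr lerD// ler_wpM2l// subr_ge0.
  move=> b; rewrite /extend /patch; case: ifPn => [/set_mem/xf//|_].
  by rewrite leey.
move=> a; rewrite /convex_closure /clf limf_einfE.
apply/lee_subgt0Pr => e e0.
have cts : continuous (fun b : 'rV[R]_N => dot x b).
  apply: continuous_dot => i; last exact: coord_continuous.
  exact: cst_continuous.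
have /(_ _ (nbhsx_ballx (dot x a) e e0)) := cts a => U.
apply: le_trans (ereal_sup_ubound _); last by exists (dot x @^-1` ball (dot x a) e).
apply: le_ereal_inf_tmp => _ [b /= /ltr_distlBl ab <-].
by apply: le_trans (lconv b); rewrite -EFinB lee_fin; move: ab; lra.
Qed.

Lemma dot_row_mx u b (s r : R) :
  dot (row_mx u (const_mx s)) (row_mx b (const_mx r : 'rV[R]_1)) = dot u b + s * r.
Proof.
rewrite /dot big_split_ord /= big_ord1 !row_mxEr !mxE; congr (_ + _).
by apply: eq_bigr => i _; rewrite !row_mxEl.
Qed.

(** Near [a] the values of [f] stay above some [t' > t], so the point (a, t) has positive distance
    to the epigraph. The sign of the height coefficient [s] is left open; [s = 0] means a vertical
    hyperplane. *)
Lemma epigraph_separation f a (t : R) :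
    convex_efun f -> (t%:E < clf f a)%E ->
  exists u (s : R), exists2 d : R, 0 < d &
    forall b (r : R), (f b <= r%:E)%E -> dot u b + s * r + d <= dot u a + s * t.
Proof.
move=> cf; rewrite /clf limf_einfE => /ereal_sup_gt[_ [V aV <-] tV].
have [t' tt' t'V] : exists2 t' : R, t < t' & (t'%:E <= ereal_inf (f @` V))%E.
  case: (ereal_inf _) tV => [r| |//]; first by rewrite lte_fin => tr; exists r.
  by move=> _; exists (t + 1); rewrite ?ltrDl// leey.
have /nbhs_ballP[/= e e0 eV] := aV.
pose C : set 'rV[R]_(N + 1) :=
  [set w | epigraph f (lsubmx w, w 0 (rshift N ord0))].
have cC : convex_set C.
  move=> p q k /set_mem pC /set_mem qC; rewrite inE /C /=.
  have := cf _ _ k (mem_set pC) (mem_set qC); rewrite inE /epigraph /=.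
  by rewrite !linearP/= !linearZ /= !mxE.
pose y : 'rV[R]_(N + 1) := row_mx a (const_mx t : 'rV[R]_1).
pose d := Num.min e (t' - t).
have d0 : 0 < d by rewrite lt_min e0 subr_gt0.
have far w : C w -> d ^+ 2 <= dot (w - y) (w - y).
  rewrite /C /epigraph /= => fw.
  have [i di] : exists i, d <= `|(w - y) 0 i|.
    have [Vw|Vw] := pselect (V (lsubmx w)).
      exists (rshift N ord0); rewrite [X in `|X|]mxE [X in _ + X]mxE row_mxEr mxE.
      have : t' <= w 0 (rshift N ord0).
        rewrite -lee_fin (le_trans t'V)// (le_trans _ fw)//.
        by apply: ereal_inf_lbound; exists (lsubmx w).
      move=> h; apply: le_trans (ler_norm _).
      by rewrite ge_min lerD2r h orbT.
    apply: contrapT => /forallNP near; apply: Vw; apply: eV; split=> // i j.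
    have /negP := near (lshift 1 j); rewrite -ltNge => h.
    rewrite (ord1 i) /ball /= distrC.
    move: h; rewrite [X in `|X|]mxE [X in _ + X]mxE row_mxEl [in X in _ -> X]mxE.
    by move/lt_le_trans; apply; rewrite ge_min lexx.
  apply: le_trans (sqr_coord_le_dot _ i).
  by rewrite -[leRHS]real_normK ?num_real//; nra.
have [v [h h0 vy]] := convex_separation C y (d ^+ 2) cC (exprn_gt0 _ d0) far.
exists (lsubmx v), (v 0 (rshift N ord0)), h => // b r fb.
have vE : v = row_mx (lsubmx v) (const_mx (v 0 (rshift N ord0))).
  rewrite -[LHS]hsubmxK; congr row_mx; apply/matrixP => i j.
  by rewrite (ord1 i) (ord1 j) !mxE.
have := vy (row_mx b (const_mx r : 'rV[R]_1)).
rewrite vE !dot_row_mx row_mxKl row_mxEr mxE; apply.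
by rewrite /C /epigraph /= row_mxKl row_mxEr mxE.
Qed.

(* Where the separating hyperplane is vertical, a large multiple of it is added
   to the minorant [x0]. *)
Lemma linear_gt_convex_closure f x0 a (t : R) :
    (forall b, PS b -> ((dot x0 b)%:E <= f b)%E) -> PS a ->
    (t%:E < convex_closure (extend (@PS R N) f) a)%E ->
  exists2 x, (forall b, PS b -> ((dot x b)%:E <= f b)%E) & t < dot x a.
Proof.
move=> x0f PSa; have [cvx lef _] := convf_greatest (extend (@PS R N) f).
move=> /(epigraph_separation _ _ _ cvx)[u [s [d d0 sep]]].
have {}sep b (r : R) : PS b -> (f b <= r%:E)%E ->
    dot u b + s * r + d <= dot u a + s * t.
  move=> PSb fr; apply: sep; apply: le_trans (lef b) _.
  by rewrite /extend /patch mem_set.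
have [s0|s0] := ltP s 0.
  (* Solving for the height gives an affine minorant that exceeds [t] at [a] by [d / - s]; the
     constant vector makes it linear on [PS]. *)
  pose x := (- s)^-1 *: u + const_mx (t - dot u a / - s + d / - s).
  have xE b : PS b -> dot x b = t + (dot u b - dot u a + d) / - s.
    by move=> PSb; rewrite dot_shift// dotZl; ring.
  have s0' : 0 < - s by rewrite oppr_gt0.
  exists x => [b PSb|]; last first.
    by rewrite xE// subrr add0r ltrDl divr_gt0.
  have := x0f _ PSb; have := sep b ^~ PSb; case: (f b) => [r|_ _|//].
    move=> /(_ r (lexx _)) h _; rewrite lee_fin xE// addrC -lerBrDr.
    by rewrite ler_pdivrMr//; lra.
  by rewrite leey.
pose M := (`|t - dot x0 a| + 1) / d.
have M0 : 0 <= M by rewrite divr_ge0 ?addr_ge0// ltW.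
pose x := x0 + M *: (u + const_mx (d - dot u a)).
have xE b : PS b -> dot x b = dot x0 b + M * (dot u b - dot u a + d).
  by move=> PSb; rewrite dotDl dotZl dot_shift//; ring.
exists x => [b PSb|]; last first.
  rewrite xE// subrr add0r /M divfK ?gt_eqF//.
  by have := ler_norm (t - dot x0 a); lra.
have := x0f _ PSb; have := sep b ^~ PSb; case: (f b) => [r|_ _|//].
  (* Raising the height to at least [t] stays in the epigraph; with [0 <= s] this makes the added
     multiple of [M] nonpositive at [b]. *)
  move=> /(_ (Num.max r t)); rewrite !lee_fin le_max lexx => /(_ isT) h.
  apply: le_trans; rewrite xE// gerDl mulr_ge0_le0//.
  have : s * t <= s * Num.max r t by rewrite ler_wpM2l// le_max lexx orbT.
  by lra.
by rewrite leey.
Qed.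

End Duality.

(** * Solid sets and their logarithmic images *)

Section Modulus.
Context {R : realType}.
Implicit Types (z w : Cplx R) (r : R).

Definition creal r : Cplx R := (r%:C)%C.

Lemma normr_cabs z : `|z| = creal (cabs z).
Proof. by []. Qed.

Lemma cabs_creal r : 0 <= r -> cabs (creal r) = r.
Proof. by move=> r0; rewrite /cabs /= expr0n addr0 sqrtr_sqr ger0_norm. Qed.

Lemma cabs_ge0 z : 0 <= cabs z.
Proof. by case: z => a b; exact: sqrtr_ge0. Qed.

Lemma cabsM z w : cabs (z * w) = cabs z * cabs w.
Proof. exact: ComplexField.Normc.normcM. Qed.

Lemma cabs_eq0 z : (cabs z == 0) = (z == 0).
Proof.
apply/eqP/eqP => [|->]; first exact: ComplexField.Normc.eq0_normc.
exact: ComplexField.Normc.normc0.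
Qed.

Lemma cabs_gt0 z : (0 < cabs z) = (z != 0).
Proof. by rewrite lt_neqAle cabs_ge0 andbT eq_sym cabs_eq0. Qed.

Lemma cabs_triangle z w : cabs (z + w) <= cabs z + cabs w.
Proof. by rewrite -lecR raddfD; exact: (ler_normD z w). Qed.

Lemma cabs_enlarge z r : 0 <= r ->
  exists2 w, cabs w = cabs z + r & cabs (w - z) = r.
Proof.
move=> r0; have [->|z0] := eqVneq z 0.
  exists (creal r); last by rewrite subr0 cabs_creal.
  by rewrite cabs_creal// (eqP (_ : cabs 0 == 0)) ?add0r// cabs_eq0.
have cz : cabs z != 0 by rewrite cabs_eq0.
have q0 : 0 <= r / cabs z by rewrite divr_ge0 ?cabs_ge0.
exists (z * creal (1 + r / cabs z)).
  by rewrite cabsM cabs_creal ?addr_ge0// mulrDr mulr1 mulrC divfK.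
rewrite -[X in _ - X]mulr1 -mulrBr cabsM.
have -> : creal (1 + r / cabs z) - 1 = creal (r / cabs z).
  by rewrite /creal raddfD /= addrC addKr.
by rewrite cabs_creal// mulrC divfK.
Qed.

End Modulus.

Section Solid.
Context {R : realType} {N : nat}.
Implicit Types (z w : 'rV[Cplx R]_N) (x y : 'rV[R]_N) (U V : set 'rV[Cplx R]_N).

(** Balls of [Cplx R] have radii in [R[i]], but a positive element there has zero imaginary part, so
    real radii suffice. *)
Lemma nbhs_cabsP z U :
  nbhs z U <-> exists2 r : R, 0 < r &
    forall w, (forall i, cabs (w 0 i - z 0 i) < r) -> U w.
Proof.
split=> [/nbhs_ballP[e /= e0 eU]|[r r0 rU]].
  have eE : e = creal (complex.Re e).
    by move: e0 {eU}; case: e => a b; rewrite ltcE /= => /andP[/eqP -> _].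
  exists (complex.Re e) => [|w hw].
    by move: e0; rewrite eE ltcR.
  apply: eU; split => // i j; rewrite (ord1 i) /ball /= distrC eE.
  by rewrite normr_cabs ltcR.
apply/nbhs_ballP; exists (creal r); first by rewrite /= ltcR.
move=> w [_ hw]; apply: rU => i; have := hw 0 i.
by rewrite /ball /= distrC normr_cabs ltcR.
Qed.

(** Shared by complete Reinhardt domains and domains of convergence; together with openness it makes
    a set recoverable from its logarithmic image. *)
Definition solid U :=
  forall z w, U z -> (forall i, cabs (w 0 i) <= cabs (z 0 i)) -> U w.

Definition expmx x : 'rV[Cplx R]_N := \row_i creal (expR (x 0 i)).

Lemma cabs_expmx x i : cabs (expmx x 0 i) = expR (x 0 i).
Proof. by rewrite mxE cabs_creal// expR_ge0. Qed.

Lemma row_enlarge z (r : R) : 0 <= r -> exists w, forall i,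
  cabs (w 0 i) = cabs (z 0 i) + r /\ cabs (w 0 i - z 0 i) = r.
Proof.
move=> r0; have h i : {v | cabs v = cabs (z 0 i) + r /\ cabs (v - z 0 i) = r}.
  by apply: cid; have [v] := cabs_enlarge (z 0 i) r r0; exists v.
by exists (\row_i sval (h i)) => i; rewrite mxE; exact: svalP (h i).
Qed.

(** All moduli of [w] are positive, so [w] has logarithmic coordinates even when [z] has zero
    entries. *)
Lemma open_enlarge U z : open U -> U z ->
  exists2 r : R, 0 < r & exists2 w, U w &
    forall i, cabs (w 0 i) = cabs (z 0 i) + r.
Proof.
move=> oU Uz; have /nbhs_cabsP[r r0 rU] := open_nbhs_nbhs (conj oU Uz).
have r20 : 0 < r / 2 by rewrite divr_gt0.
exists (r / 2) => //.
have [w wz] := row_enlarge z (r / 2) (ltW r20).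
exists w => [|i]; last by case: (wz i).
apply: rU => i; case: (wz i) => _ ->.
by rewrite ltr_pdivrMr// ltr_pMr// ltr1n.
Qed.

(** Only moduli matter for membership in a solid set, so a single positive preimage of [x]
    decides. *)
Lemma log_imageE U x : solid U -> log_image U x <-> U (expmx x).
Proof.
move=> sU; split=> [[z [Uz z0] <-]|Ux].
  apply: sU Uz _ => i; rewrite cabs_expmx mxE lnK// posrE cabs_gt0.
  exact: z0.
exists (expmx x); last by apply/rowP => i; rewrite mxE cabs_expmx expRK.
by split=> // i; rewrite -cabs_gt0 cabs_expmx expR_gt0.
Qed.

Lemma log_image_down U x y : solid U ->
  log_image U x -> (forall i, y 0 i <= x 0 i) -> log_image U y.
Proof.
move=> sU /(log_imageE _ _ sU) Ux yx; apply/log_imageE => //.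
by apply: sU Ux _ => i; rewrite !cabs_expmx ler_expR.
Qed.

Lemma log_image_shift U x : open U -> solid U -> log_image U x ->
  exists2 e : R, 0 < e & log_image U (x + const_mx e).
Proof.
move=> oU sU /(log_imageE _ _ sU) /(open_enlarge _ _ oU)[r r0 [w Uw wx]].
(* [B] exceeds every [expR (x 0 i)], so the factor [1 + r / B] adds at most [r] to each modulus. *)
pose B := 1 + \sum_i expR (x 0 i).
have B0 : 0 < B by rewrite ltr_pwDl// sumr_ge0// => i _; exact: expR_ge0.
have rB0 : 0 < r / B by rewrite divr_gt0.
exists (ln (1 + r / B)); first by rewrite ln_gt0// ltrDl.
apply/log_imageE => //; apply: sU Uw _ => i.
rewrite wx !cabs_expmx !mxE expRD lnK ?posrE ?addr_gt0// mulrDr mulr1 lerD2l.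
rewrite mulrCA ger_pMr// ler_pdivrMr// mul1r /B (bigD1 i)//= addrCA lerDl.
by rewrite addr_ge0// sumr_ge0// => j _; exact: expR_ge0.
Qed.

Lemma mem_log_image U z : open U -> solid U ->
  U z <-> exists2 x, log_image U x & forall i, cabs (z 0 i) <= expR (x 0 i).
Proof.
move=> oU sU; split=> [/(open_enlarge _ _ oU)[r r0 [w Uw wz]]|[x]].
  have w0 i : 0 < cabs (w 0 i) by rewrite wz ltr_wpDl// cabs_ge0.
  exists (log_map w); first by exists w => //; split=> // i; rewrite -cabs_gt0.
  by move=> i; rewrite mxE lnK ?posrE// wz lerDl ltW.
move=> /(log_imageE _ _ sU) Ux zx; apply: sU Ux _ => i.
by rewrite cabs_expmx.
Qed.

Lemma log_image_inj U V : open U -> solid U -> open V -> solid V ->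
  (forall x, log_image U x <-> log_image V x) -> U = V.
Proof.
move=> oU sU oV sV UV; apply/seteqP; split => z.
  move/(mem_log_image _ _ oU sU) => [x /UV Vx zx].
  by apply/(mem_log_image _ _ oV sV); exists x.
move/(mem_log_image _ _ oV sV) => [x /UV Ux zx].
by apply/(mem_log_image _ _ oU sU); exists x.
Qed.

Lemma log_image_nonempty U : open U -> solid U -> U !=set0 -> log_image U !=set0.
Proof. by move=> oU sU [z /(mem_log_image _ _ oU sU)[x Ux _]]; exists x. Qed.

Lemma complete_reinhardt_solid U : complete_reinhardt U -> solid U.
Proof.
move=> [A _ ->] z w [r Ar zr] wz; exists r => // i.
exact: le_lt_trans (wz i) (zr i).
Qed.

End Solid.

(** * Convergence of power series *)

Section LimitSuperior.
Context {R : realType}.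

(** Meant for the quotients log|c_J| / |J|, which are -oo at vanishing coefficients; the comparison
    sequence is real. *)
Lemma limn_esup_le_lim (u : (\bar R)^nat) (v : R^nat) (l : R) :
    (forall n, (u n <= (v n)%:E)%E) -> v n @[n --> \oo] --> l ->
  (limn_esup u <= l%:E)%E.
Proof.
move=> uv vl; apply/lee_addgt0Pr => e e0.
rewrite /limn_esup limf_esupE.
have A : \forall n \near \oo, v n < l + e.
  by apply: cvgr_lt vl _ _; rewrite ltrDl.
apply: le_trans (ereal_inf_lbound _) _; first by exists [set n | v n < l + e].
apply: ge_ereal_sup => _ [n /= vn <-]; apply: le_trans (uv n) _.
by rewrite -EFinD lee_fin ltW.
Qed.

Lemma limn_esup_ge_lim (u : (\bar R)^nat) (v : R^nat) (l : R) :
    (forall n, ((v n)%:E <= u n)%E) -> v n @[n --> \oo] --> l ->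
  (l%:E <= limn_esup u)%E.
Proof.
move=> vu vl; apply/lee_subgt0Pr => e e0.
rewrite /limn_esup limf_esupE; apply: le_ereal_inf_tmp => _ [V Voo <-].
have A : \forall n \near \oo, l - e < v n.
  by apply: cvgr_gt vl _ _; rewrite gtrDl oppr_lt0.
have [n [Vn vn]] := filter_ex (filterI Voo A).
apply: le_trans (ereal_sup_ubound _); last by exists n.
by apply: le_trans (vu n); rewrite -EFinB lee_fin ltW.
Qed.

End LimitSuperior.

(** * Absolute convergence: geometric comparison and solidity *)

Section Summability.
Context {R : realType} {N : nat}.
Implicit Types (J : mindex N) (c : mindex N -> Cplx R).
Implicit Types (z w : 'rV[Cplx R]_N).

(** Parametrises a box of indices by a finite function type, over which sums of products factor. *)
Definition mindex_of n (f : {ffun 'I_N -> 'I_n}) : mindex N :=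
  [ffun i => val (f i)].

Lemma mindex_of_surj n J : (forall i, (J i < n)%N) -> exists f, J = @mindex_of n f.
Proof.
by move=> Jn; exists [ffun i => Ordinal (Jn i)]; apply/ffunP => i; rewrite !ffunE.
Qed.

Lemma mindex_le_mlength J i : (J i <= mlength J)%N.
Proof. by rewrite /mlength (bigD1 i)//= leq_addr. Qed.

Lemma geometric_sum_le (r : R) n : 0 <= r -> r < 1 ->
  \sum_(i < n) r ^+ i <= (1 - r)^-1.
Proof.
move=> r0 r1; rewrite -[leRHS]mul1r ler_pdivlMr ?subr_gt0//.
have := subrX1 r n; set s := \sum_(i < n) _ => h.
have : 0 <= r ^+ n by rewrite exprn_ge0.
by lra.
Qed.

(** A finite set of indices lies in a box, and over a box the sum of [r ^+ mlength J] is the [N]-th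
    power of a finite geometric sum. *)
Lemma summable_mlength (a : mindex N -> R) (M r : R) :
    0 <= M -> 0 <= r -> r < 1 ->
    (forall J, 0 <= a J <= M * r ^+ mlength J) ->
  summable [set: mindex N] (fun J => (a J)%:E).
Proof.
move=> M0 r0 r1 aM.
apply: (@le_lt_trans _ _ (M * (1 - r)^-1 ^+ N)%:E); last by rewrite ltry.
apply: ge_ereal_sup => _ [A [finA _] <-].
have [n An] : exists n, forall J, A J -> forall i, (J i < n)%N.
  exists (\max_(J <- finmap.enum_fset (fset_set A)) mlength J).+1 => J AJ i.
  rewrite ltnS (leq_trans (mindex_le_mlength J i))//.
  by apply: leq_bigmax_seq => //; rewrite in_fset_set// inE.
pose B := range (@mindex_of n).
have finB : finite_set B by apply: finite_image; exact: finite_finset.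
apply: (@le_trans _ _ (\sum_(J \in B) (M * r ^+ mlength J)%:E)%E).
  apply: (@le_trans _ _ (\sum_(J \in A) (M * r ^+ mlength J)%:E)%E).
    apply: lee_fsum => // J _.
    by rewrite lee_fin ger0_norm; case/andP: (aM J).
  apply: lee_fsum_nneg_subset => // [J|J _].
    by rewrite !inE => /An/mindex_of_surj[f ->]; exists f.
  by rewrite lee_fin mulr_ge0// exprn_ge0.
rewrite fsumEFin// lee_fin fsbig_image; last first.
  move=> f g _ _ /ffunP fg; apply/ffunP => i; apply: val_inj.
  by have := fg i; rewrite !ffunE.
have -> : [set: {ffun 'I_N -> 'I_n}] = [set` index_enum {ffun 'I_N -> 'I_n}].
  by apply/seteqP; split => f //= _; rewrite mem_index_enum.
rewrite -fsbig_seq ?index_enum_uniq// -mulr_sumr ler_wpM2l//.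
under eq_bigr => f _.
  rewrite /mlength -prodrXr; under eq_bigr do rewrite ffunE; over.
rewrite -(bigA_distr_bigA (fun=> fun k : 'I_n => r ^+ k)) /=.
rewrite prodr_const card_ord; apply: lerXn2r.
- by rewrite nnegrE sumr_ge0// => i _; rewrite exprn_ge0.
- by rewrite nnegrE invr_ge0 subr_ge0 ltW.
- exact: geometric_sum_le.
Qed.

Lemma monomial_cabs c J z :
  cabs (c J * monomial J z) = cabs (c J) * \prod_i cabs (z 0 i) ^+ J i.
Proof.
rewrite cabsM; congr (_ * _); rewrite /monomial.
rewrite (big_morph _ cabsM (id1 := 1)); last exact: ComplexField.Normc.normc1.
apply: eq_bigr => i _; elim: (J i) => [|k IH].
  by rewrite !expr0; exact: ComplexField.Normc.normc1.
by rewrite !exprS cabsM IH.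
Qed.

Lemma abs_convergent_bounded c z : abs_convergent c z ->
  exists2 M : R, 0 < M & forall J, cabs (c J * monomial J z) <= M.
Proof.
move=> cz; pose s := (\esum_(J in [set: mindex N]) `|(cabs (c J * monomial J z))%:E|)%E.
have s0 : (0 <= s)%E by apply: esum_ge0 => J _; exact: abse_ge0.
have sfin : s \is a fin_num by rewrite ge0_fin_numE.
(* The [+ 1] makes the bound positive, so that its logarithm can be taken. *)
exists (fine s + 1) => [|J]; first by rewrite ltr_wpDl ?fine_ge0.
rewrite ler_wpDr// -lee_fin fineK//; apply: esum_ge.
exists [set J]; first by split => //; exact: finite_set1.
by rewrite fsbig_set1 /= ger0_norm ?cabs_ge0.
Qed.

Lemma abs_convergent_solid c : solid (abs_convergent c).
Proof.
move=> z w cz wz; apply: le_lt_trans cz; apply: le_esum => J _.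
rewrite lee_fin !ger0_norm ?cabs_ge0// !monomial_cabs ler_wpM2l ?cabs_ge0//.
by apply: ler_prod => i _; rewrite exprn_ge0 ?cabs_ge0//= lerXn2r ?nnegrE ?cabs_ge0.
Qed.

Lemma domain_of_convergence_open c : open (domain_of_convergence c).
Proof. exact: open_interior. Qed.

(** A point within [r / 2] of [w] has moduli at most those of [z] plus [r / 2], and some point
    within [r] of [z] has exactly these larger moduli. *)
Lemma domain_of_convergence_solid c : solid (domain_of_convergence c).
Proof.
move=> z w /nbhs_cabsP[r r0 rc] wz; apply/nbhs_cabsP.
have r20 : 0 < r / 2 by rewrite divr_gt0.
exists (r / 2) => // w' w'w.
have [v vz] := row_enlarge z (r / 2) (ltW r20).
apply: (@abs_convergent_solid c v).
  apply: rc => i; case: (vz i) => _ ->.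
  by rewrite ltr_pdivrMr// ltr_pMr// ltr1n.
move=> i; case: (vz i) => -> _.
rewrite -(subrK (w 0 i) (w' 0 i)) (le_trans (cabs_triangle _ _))//.
by rewrite addrC lerD// ltW.
Qed.

End Summability.

(** * Directions J/|J| and the growth of coefficients *)

Section Directions.
Context {R : realType} {N : nat}.
Implicit Types (J : mindex N) (c : mindex N -> Cplx R).
Implicit Types (x y a : 'rV[R]_N).

Definition mdir J : 'rV[R]_N := \row_i ((J i)%:R / (mlength J)%:R).

Lemma PS_mdir J : (0 < mlength J)%N -> PS (mdir J).
Proof.
move=> J0; split=> [|i]; last by rewrite mxE divr_ge0.
under eq_bigr do rewrite mxE; rewrite -mulr_suml -natr_sum divff//.
by rewrite pnatr_eq0 -lt0n.
Qed.

Lemma compact_PS : compact (@PS R N).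
Proof.
apply: bounded_closed_compact.
  exists 1; split=> [|M /ltW M1 x [x1 x0]]; first exact: num_real.
  rewrite /= (le_trans _ M1)// /Num.norm/= mx_normrE.
  apply/bigmax_leP; split=> // -[i j] _ /=; rewrite (ord1 i) ger0_norm//.
  by rewrite -x1 (bigD1 j)//= lerDl sumr_ge0.
have -> : @PS R N = [set x | dot x (const_mx 1) = 1] `&`
    \bigcap_(i in setT) [set x : 'rV[R]_N | 0 <= x 0 i].
  have E x : dot x (const_mx 1) = \sum_i x 0 i.
    by apply: eq_bigr => i _; rewrite mxE mulr1.
  apply/seteqP; split=> [x [x1 x0]|x [/= x1 x0]].
    by split=> /=; [rewrite E|move=> i _; exact: x0].
  by split=> [|i]; [rewrite -E|exact: x0].
apply: closedI.
  have cts : continuous (fun x : 'rV[R]_N => dot x (const_mx 1)).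
    by apply: continuous_dot => i; [exact: coord_continuous|exact: cst_continuous].
  exact: closed_comp (fun x _ => cts x) (@closed_eq _ _).
apply: closed_bigI => i _.
exact: closed_comp (fun x _ => @coord_continuous _ _ _ 0 i x) (@closed_ge _ _).
Qed.

(** Splits the exponent of a term into length and direction, which reduces convergence to growth
    rates by direction. *)
Lemma term_expmx c J y : (0 < mlength J)%N ->
  cabs (c J * monomial J (expmx y)) =
    cabs (c J) * expR ((mlength J)%:R * dot y (mdir J)).
Proof.
move=> J0; rewrite monomial_cabs; congr (_ * _).
rewrite /dot mulr_sumr expR_sum; apply: eq_bigr => i _.
rewrite cabs_expmx -expRM_natl !mxE; congr expR.
by field; rewrite pnatr_eq0 -lt0n.
Qed.

Lemma Sseq_mlength_gt0 a (J : nat -> mindex N) n : Sseq a J -> (0 < mlength (J n))%N.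
Proof.
move=> [J0 _ _]; rewrite lt0n; apply/eqP => Jn; apply: (J0 n).
apply/ffunP => i; rewrite ffunE; apply/eqP.
by rewrite -leqn0 -Jn mindex_le_mlength.
Qed.

Lemma Sseq_dot a y (J : nat -> mindex N) : Sseq a J ->
  dot y (mdir (J n)) @[n --> \oo] --> dot y a.
Proof.
move=> [_ Ja _].
have cts : continuous (fun x : 'rV[R]_N => dot y x).
  by apply: continuous_dot => i; [exact: cst_continuous|exact: coord_continuous].
exact: continuous_cvg (cts a) Ja.
Qed.

Lemma ln_cabs_quotient c J (l : R) : (0 < mlength J)%N ->
    cabs (c J) <= expR ((mlength J)%:R * l) ->
  (lne (cabs (c J))%:E * ((mlength J)%:R^-1)%:E <= l%:E)%E.
Proof.
move=> J0 cl; have m0 : 0 < (mlength J)%:R :> R by rewrite ltr0n.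
have [c0|c0] := eqVneq (cabs (c J)) 0.
  by rewrite c0 le0_lneNy// gt0_mulNye ?leNye// lte_fin invr_gt0.
have {}c0 : 0 < cabs (c J) by rewrite lt_neqAle eq_sym c0 cabs_ge0.
rewrite lne_EFin// -EFinM lee_fin ler_pdivrMr// mulrC.
by rewrite -ler_expR lnK// posrE.
Qed.

Lemma ln_cabs_quotient_ge c J (l : R) : (0 < mlength J)%N ->
    expR ((mlength J)%:R * l) <= cabs (c J) ->
  (l%:E <= lne (cabs (c J))%:E * ((mlength J)%:R^-1)%:E)%E.
Proof.
move=> J0 cl; have m0 : 0 < (mlength J)%:R :> R by rewrite ltr0n.
have c0 := lt_le_trans (expR_gt0 _) cl.
rewrite lne_EFin// -EFinM lee_fin ler_pdivlMr// mulrC.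
by rewrite -ler_expR lnK// posrE.
Qed.

(** Terms bounded by [M] give log|c_J| / |J| <= log M / |J| - <y, J/|J|>, and the right side tends
    to -<y, a> along every sequence in [Sseq a]. *)
Lemma abs_convergent_coef_fun c y : abs_convergent c (expmx y) ->
  forall a, PS a -> ((dot y a)%:E <= coef_fun c a)%E.
Proof.
move=> /abs_convergent_bounded[M M0 cM] a _.
rewrite /coef_fun leeNr; apply: ge_ereal_sup => _ [J Ja <-].
have J0 n := Sseq_mlength_gt0 _ _ n Ja.
pose v n := ln M * ((mlength (J n))%:R^-1) - dot y (mdir (J n)).
rewrite -EFinN; apply: (limn_esup_le_lim _ v).
  move=> n; apply: ln_cabs_quotient => //.
  have m0 : (mlength (J n))%:R != 0 :> R by rewrite pnatr_eq0 -lt0n.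
  rewrite /v mulrBr expRB mulrCA divff// mulr1 lnK ?posrE//.
  by rewrite ler_pdivlMr ?expR_gt0// -term_expmx.
rewrite -[- _]add0r -[X in X + _](mulr0 (ln M)).
apply: cvgB; last exact: Sseq_dot.
apply: cvgMr; case: Ja => _ _ Joo.
apply/gtr0_cvgV0; first by apply: nearW => n; rewrite ltr0n.
exact/cvgrnyP.
Qed.

(** Pick [p k] at least [k] with [u (p k)] within 1/(k+1) of a cluster point; [k <= p k] alone makes
    the indices diverge. *)
Lemma compact_cluster_subseq (u : nat -> 'rV[R]_N) (A : set 'rV[R]_N) :
    compact A -> (forall n, A (u n)) ->
  exists2 a, A a & exists2 p : nat -> nat, (forall k, (k <= p k)%N) &
    u (p k) @[k --> \oo] --> a.
Proof.
move=> cA uA.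
have FA : (u @ \oo) A by exists 0%N => // n _; exact: uA.
have [a [Aa clA]] := cA (u @ \oo) _ FA.
exists a => //.
have h k : {n | (k <= n)%N /\ ball a (k.+1%:R^-1 : R) (u n)}.
  apply: cid; have e0 : 0 < k.+1%:R^-1 :> R by rewrite invr_gt0.
  have U : (u @ \oo) (u @` [set n | (k <= n)%N]).
    by exists k => // n /= kn; exists n.
  have [_ [[n kn <-] ua]] := clA _ _ U (nbhsx_ballx a _ e0).
  by exists n.
exists (fun k => sval (h k)) => [k|]; first by case: (svalP (h k)).
apply/cvg_ballP => e e0.
have := near_infty_natSinv_lt (PosNum e0); apply: filterS => k /ltW ke.
by case: (svalP (h k)) => _; exact: le_ball.
Qed.

(** Otherwise there are violating indices of arbitrarily large length. Their directions cluster at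
    some [a] in [PS], and the resulting sequence in [Sseq a] forces [coef_fun c a] down to
    [dot y a - e] or less. *)
Lemma coef_fun_bound c y (e : R) : 0 < e ->
    (forall a, PS a -> ((dot y a)%:E <= coef_fun c a)%E) ->
  exists n, forall J, (n < mlength J)%N ->
    cabs (c J) <= expR ((mlength J)%:R * (e - dot y (mdir J))).
Proof.
move=> e0 yc; apply: contrapT => /forallNP bad.
have h n : {J | (n < mlength J)%N /\
    expR ((mlength J)%:R * (e - dot y (mdir J))) < cabs (c J)}.
  apply: cid; have /existsNP[J] := bad n.
  by move=> /not_implyP[nJ /negP]; rewrite -ltNge; exists J.
pose J n := sval (h n).
have nJ n : (n < mlength (J n))%N by case: (svalP (h n)).
have J0 n : (0 < mlength (J n))%N by apply: leq_ltn_trans (nJ n).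
have [a PSa [p kp pa]] :=
  compact_cluster_subseq (fun n => mdir (J n)) _ compact_PS (fun n => PS_mdir _ (J0 n)).
have SJ : Sseq a (J \o p).
  split=> [k Jk|//|].
    have := J0 (p k); rewrite -/((J \o p) k) Jk /mlength big1// => i _.
    by rewrite ffunE.
  apply/cvgnyPge => A; exists A => // k /= Ak.
  exact: leq_trans Ak (leq_trans (kp k) (ltnW (nJ _))).
have := yc a PSa; apply/negP; rewrite -ltNge /coef_fun lteNl -EFinN.
apply: lt_le_trans (ereal_sup_ubound _); last by exists (J \o p).
apply: (@lt_le_trans _ _ (e - dot y a)%:E); first by rewrite lte_fin ltrDr.
apply: (limn_esup_ge_lim _ (fun n => e - dot y (mdir (J (p n))))).
  move=> n; apply: ln_cabs_quotient_ge => //=.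
  by apply: ltW; case: (svalP (h (p n))).
by apply: cvgB; [exact: cvg_cst|exact: Sseq_dot SJ].
Qed.

(** Half of the margin [e] is spent on [coef_fun_bound]; the other half leaves a geometric ratio
    [expR (- (e / 2))]. *)
Lemma coef_fun_abs_convergent c y (e : R) : 0 < e ->
    (forall a, PS a -> ((dot (y + const_mx e) a)%:E <= coef_fun c a)%E) ->
  abs_convergent c (expmx y).
Proof.
move=> e0 /(coef_fun_bound _ _ (e / 2))[|n cn]; first by rewrite divr_gt0.
pose r := expR (- (e / 2)).
have r0 : 0 < r by rewrite expR_gt0.
have r1 : r < 1 by rewrite expR_lt1 oppr_lt0 divr_gt0.
pose t J := cabs (c J * monomial J (expmx y)).
have t0 J : 0 <= t J by exact: cabs_ge0.
(* Indices of length at most [n] have entries below [n.+1], and the sum makes [M * r ^+ mlength J]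
   dominate their terms; the 1 serves the longer indices. *)
pose M := 1 + \sum_(f : {ffun 'I_N -> 'I_n.+1})
  t (mindex_of _ f) / r ^+ mlength (mindex_of _ f).
have M1 : 1 <= M.
  by rewrite lerDl sumr_ge0// => f _; rewrite divr_ge0// exprn_ge0// ltW.
apply: (summable_mlength _ M r (le_trans ler01 M1) (ltW r0) r1).
move=> J; rewrite -/(t J) t0 /=; have [nJ|Jn] := ltnP n (mlength J).
  have J0 : (0 < mlength J)%N by apply: leq_ltn_trans nJ.
  apply: (@le_trans _ _ (r ^+ mlength J)); last first.
    by rewrite ler_peMl// exprn_ge0// ltW.
  rewrite /t term_expmx// -ler_pdivlMr ?expR_gt0// -expRM_natl -expRB.
  apply: le_trans (cn J nJ) _; rewrite ler_expR dot_shift; last exact: PS_mdir.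
  by rewrite le_eqVlt; apply/orP; left; apply/eqP; field.
have [f ->] : exists f, J = @mindex_of N n.+1 f.
  by apply: mindex_of_surj => i; rewrite ltnS (leq_trans _ Jn)// mindex_le_mlength.
rewrite -ler_pdivrMr ?exprn_gt0// /M (bigD1 f)//= addrCA lerDl addr_ge0//.
by apply: sumr_ge0 => g _; rewrite divr_ge0// exprn_ge0// ltW.
Qed.

(** The margin [e] accounts for taking the interior: openness provides it, and conversely
    convergence at [expmx (x + const_mx (e / 2))] spreads by solidity to a neighbourhood of
    [expmx x]. *)
Lemma log_image_domain_of_convergence c x :
  log_image (domain_of_convergence c) x <-> exists2 e : R, 0 < e &
    forall a, PS a -> ((dot (x + const_mx e) a)%:E <= coef_fun c a)%E.
Proof.
have oc := domain_of_convergence_open c.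
have sc := domain_of_convergence_solid c.
split=> [/(log_image_shift _ _ oc sc)[e e0 /(log_imageE _ _ sc)]|[e e0 xc]].
  by move=> /interior_subset/abs_convergent_coef_fun; exists e.
have e20 : 0 < e / 2 by rewrite divr_gt0.
have xe2 : abs_convergent c (expmx (x + const_mx (e / 2))).
  apply: (coef_fun_abs_convergent _ _ (e / 2)) => // a PSa.
  by rewrite !dot_shift// -addrA -splitr -dot_shift//; exact: xc.
apply/log_imageE => //; apply/nbhs_cabsP.
(* [m] is a lower bound of all [expR (x 0 i)], so moving each entry by less than
   [m * (expR (e / 2) - 1)] keeps its modulus below [expR (x 0 i + e / 2)]. *)
pose m := expR (- \sum_i `|x 0 i|).
have mx i : m <= expR (x 0 i).
  rewrite ler_expR lerNl (le_trans (ler_norm _))// normrN.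
  by rewrite (bigD1 i)//= lerDl sumr_ge0.
have q0 : 0 < expR (e / 2) - 1 by rewrite subr_gt0 expR_gt1.
exists (m * (expR (e / 2) - 1)) => [|w xw]; first by rewrite mulr_gt0// expR_gt0.
apply: (abs_convergent_solid c _ _ xe2) => i; rewrite cabs_expmx.
rewrite -(subrK (expmx x 0 i) (w 0 i)) (le_trans (cabs_triangle _ _))//.
rewrite cabs_expmx [X in _ <= expR X]mxE expRD -lerBrDr.
apply: le_trans (ltW (xw i)) _.
by rewrite mxE -[X in _ <= _ - X]mulr1 -mulrBr ler_pM2r.
Qed.

End Directions.

Theorem theorem3p3 (R : realType) (N : nat) (N_gt0 : (0 < N)%N)
    (D : set 'rV[Cplx R]_N)
    (D_domain : domain D) (D_reinhardt : complete_reinhardt D)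
    (D_log_convex : log_convex D)
    (c : mindex N -> Cplx R)
    (c_convergent : domain_of_convergence c !=set0) :
  domain_of_convergence c = D <->
  (forall alpha : 'rV[R]_N, PS alpha ->
    support_function (log_image D) alpha
      = convex_closure (extend (@PS R N) (coef_fun c)) alpha).
Proof.
have [D0 oD _] := D_domain.
have sD := complete_reinhardt_solid _ D_reinhardt.
have oc := domain_of_convergence_open c.
have sc := domain_of_convergence_solid c.
split=> [cD a PSa|hc].
  have GD x := log_image_domain_of_convergence c x; rewrite cD in GD.
  apply/eqP; rewrite eq_le; apply/andP; split.
    apply: support_function_le => x /GD[e e0 xc].
    apply: linear_le_convex_closure => b PSb.
    by apply: le_trans (xc b PSb); rewrite dot_shift// lee_fin lerDl ltW.
  rewrite leNgt; apply/negP => hF.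
  have [x0 Gx0] := log_image_nonempty _ oD sD D0.
  have x0c b : PS b -> ((dot x0 b)%:E <= coef_fun c b)%E.
    move=> PSb; have /GD[e e0 /(_ b PSb)] := Gx0; apply: le_trans.
    by rewrite dot_shift// lee_fin lerDl ltW.
  (* [x0] bounds the value from below, and the strict inequality [hF] excludes +oo. *)
  have [r hr] : exists r, support_function (log_image D) a = r%:E.
    have := support_function_ge _ _ a Gx0; move: hF.
    case: (support_function _ a) => [r _ _|+ _|_ //]; first by exists r.
    by rewrite ltNge leey.
  rewrite hr in hF.
  have [x xc rx] := linear_gt_convex_closure _ _ _ _ x0c PSa hF.
  (* Lowering [x] by half its excess over [r] at [a] puts it in the logarithmic image, yet leaves it
     above [r] at [a]. *)
  pose e := (dot x a - r) / 2.
  have e0 : 0 < e by rewrite divr_gt0// subr_gt0.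
  have /(support_function_ge _ _ a) : log_image D (x + const_mx (- e)).
    apply/GD; exists e => // b PSb.
    by rewrite !dot_shift// subrK; exact: xc.
  by rewrite hr lee_fin dot_shift// /e; lra.
(* Both sets are open and solid, so comparing logarithmic images suffices; the same margin [e] works
   on both sides. *)
apply: log_image_inj => // x.
have memD := mem_support_function (log_image D) x D_log_convex
  (log_image_nonempty _ oD sD D0) (fun y z => log_image_down _ y z sD)
  (fun y => log_image_shift _ y oD sD).
split=> [/log_image_domain_of_convergence[e e0 xc]|/memD[e e0 xh]].
  apply/memD; exists e => // a PSa.
  by rewrite hc//; exact: linear_le_convex_closure.
apply/log_image_domain_of_convergence; exists e => // a PSa.
apply: le_trans (xh a PSa) _; rewrite hc//.
apply: le_trans (convex_closure_le _ _) _.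
by rewrite /extend /patch mem_set.
Qed.
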